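(* Let $n\ge 2$ and let $\mathcal{CR}(\sigma_n) \subseteq \mathcal{S}(\sigma_n)$ be the space of chain recurrent subshifts of the full $n$-shift. Then $\mathcal{CR}(\sigma_n)$ is the closure in $\mathcal{S}(\sigma_n)$ of the set of finite subshifts.
   Context: $X_n=\{0,\dots,n-1\}^{\mathbb{Z}}$ with the product topology (and a compatible metric), $\sigma_n$ is the shift $(\sigma_n(x))_i=x_{i+1}$. $\mathcal{S}(\sigma_n)$ is the space of all nonempty compact $Y\subseteq X_n$ with $\sigma_n(Y)=Y$ (subshifts), with the Hausdorff metric. A subshift $Y$ is chain recurrent if for every $x\in Y$ and $\epsilon>0$ there is a finite sequence $x=x_0,\dots,x_r=x$ ($r\ge1$) in $Y$ with $d(\sigma_n(x_i),x_{i+1})<\epsilon$ for all $0\le i<r$. A finite subshift is an element of $\mathcal{S}(\sigma_n)$ which is a finite set. *)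

(* Defs.v *)
From HB Require Import structures.
From mathcomp Require Import all_boot all_order all_algebra.
From mathcomp Require Import all_classical all_reals all_analysis.
Set Implicit Arguments.
Unset Strict Implicit.
Unset Printing Implicit Defensive.
Import Order.TTheory GRing.Theory Num.Theory.
Import numFieldNormedType.Exports.
Local Open Scope classical_set_scope.
Local Open Scope ring_scope.

(* A metric inducing the topology that [T] already carries. *)
Record compatible_metric (R : realType) (T : topologicalType) :=
  CompatibleMetric {
    cdist :> T -> T -> R;
    cdistxx : forall x, cdist x x = 0;
    cdist_positivity : forall x y, cdist x y = 0 -> x = y;
    cdist_sym : forall x y, cdist x y = cdist y x;
    cdist_triangle : forall y x z, cdist x z <= cdist x y + cdist y z;
    cdist_nbhs : forall (x : T) (A : set T),
      nbhs x A <-> exists2 e : R, 0 < e & [set y | cdist x y < e] `<=` A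
  }.

Section hausdorff_distance.
Context {R : realType} {T : topologicalType} (d : compatible_metric R T).

Definition set_dist (x : T) (Z : set T) : R := inf [set d x z | z in Z].

Definition hausdorff_dist (Y Z : set T) : R :=
  Num.max (sup [set set_dist y Z | y in Y]) (sup [set set_dist z Y | z in Z]).

Lemma cdist_ge0 x y : 0 <= d x y.
Proof.
rewrite -(@pmulrn_lge0 _ _ 2)// -(cdistxx d x).
by rewrite (le_trans (cdist_triangle d y _ _))// (cdist_sym d y) -mulr2n.
Qed.

Let dist_lb x Z : has_lbound [set d x z | z in Z].
Proof. by exists 0 => _ [z _ <-]; exact: cdist_ge0. Qed.

Lemma set_dist_ge0 x Z : Z !=set0 -> 0 <= set_dist x Z.
Proof.
move=> [z Zz]; apply: lb_le_inf; first by exists (d x z), z.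
by move=> _ [w _ <-]; exact: cdist_ge0.
Qed.

Lemma set_dist_le x z Z : Z z -> set_dist x Z <= d x z.
Proof. by move=> Zz; apply: ge_inf => //; exists z. Qed.

Lemma set_dist_lt x Z (e : R) : Z !=set0 -> 0 < e ->
  exists2 z, Z z & d x z < set_dist x Z + e.
Proof.
move=> [z0 Zz0] e0.
have [|_ [z Zz <-] ze] := @inf_adherent _ [set d x z | z in Z] _ e0.
  by split; [exists (d x z0), z0|].
by exists z.
Qed.

Lemma set_dist0 x Z : Z x -> set_dist x Z = 0.
Proof.
move=> Zx; apply/eqP; rewrite eq_le set_dist_ge0 ?andbT; last by exists x.
by rewrite -[leRHS](cdistxx d x) set_dist_le.
Qed.

Lemma set_dist_triangle x y Z : Z !=set0 ->
  set_dist x Z <= d x y + set_dist y Z.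
Proof.
move=> Z0; apply/ler_addgt0Pl => e e0.
have [z Zz ze] := set_dist_lt y Z0 e0.
rewrite (le_trans (set_dist_le x Zz))// (le_trans (cdist_triangle d y _ _))//.
by rewrite addrCA lerD2l addrC ltW.
Qed.

Lemma compatible_hausdorff : hausdorff_space T.
Proof.
move=> p q pq; apply/(cdist_positivity (c := d))/eqP.
rewrite eq_le cdist_ge0 andbT leNgt; apply/negP => D0.
have D2 : 0 < d p q / 2 by rewrite divr_gt0.
have nb x : nbhs x [set y | d x y < d p q / 2].
  by apply/(cdist_nbhs d); exists (d p q / 2).
have [x [/= px qx]] := pq _ _ (nb p) (nb q).
have := cdist_triangle d x p q; rewrite leNgt => /negP; apply.
by rewrite [ltRHS]splitr ltrD// cdist_sym.
Qed.

Lemma set_dist_eq0 x Z : Z !=set0 -> compact Z -> set_dist x Z = 0 -> Z x.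
Proof.
move=> Z0 /(compact_closed compatible_hausdorff) cZ xZ0; apply: cZ => B.
move=> /(cdist_nbhs d) [e e0 eB].
have [z Zz] := set_dist_lt x Z0 e0; rewrite xZ0 add0r => ze.
by exists z; split => //; exact: eB.
Qed.

Lemma cdist_continuous x : continuous (d x : T -> R^o).
Proof.
move=> y; apply/cvgrPdist_lt => e e0; apply/(cdist_nbhs d); exists e => // z /=.
move=> yz; rewrite (le_lt_trans _ yz)// ler_norml lerBlDr lerBrDr.
rewrite [d y z]cdist_sym addrC lerBlDr.
rewrite (le_trans (cdist_triangle d y _ _)) ?[d y z]cdist_sym//=.
by rewrite addrC cdist_triangle.
Qed.

Lemma set_dist_ub Y Z : compact Y -> Z !=set0 ->
  has_ubound [set set_dist y Z | y in Y].
Proof.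
move=> cY [z Zz].
have /compact_bounded [M [_ MY]] : compact ((d z : T -> R^o) @` Y).
  by apply: continuous_compact => //; apply: continuous_subspaceT;
     exact: cdist_continuous.
exists (M + 1) => _ [y Yy <-].
rewrite (le_trans (set_dist_le y Zz))// cdist_sym (le_trans (ler_norm _))//.
by apply: (MY (M + 1)); [rewrite ltrDl|exists y].
Qed.

Lemma hausdorff_dist_le Y Z (e : R) : Y !=set0 -> compact Y ->
    Z !=set0 -> compact Z ->
  hausdorff_dist Y Z <= e <->
  (forall y, Y y -> set_dist y Z <= e) /\ (forall z, Z z -> set_dist z Y <= e).
Proof.
move=> Y0 cY Z0 cZ; rewrite /hausdorff_dist ge_max; split.
  case/andP => YZ ZY; split => x Xx.
    by apply: le_trans YZ; apply: ub_le_sup; [exact: set_dist_ub|exists x].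
  by apply: le_trans ZY; apply: ub_le_sup; [exact: set_dist_ub|exists x].
move=> [YZ ZY]; apply/andP; split; apply: ge_sup.
- by have [y Yy] := Y0; exists (set_dist y Z), y.
- by move=> _ [y Yy <-]; exact: YZ.
- by have [z Zz] := Z0; exists (set_dist z Y), z.
- by move=> _ [z Zz <-]; exact: ZY.
Qed.

Lemma hausdorff_dist_sym Y Z : hausdorff_dist Y Z = hausdorff_dist Z Y.
Proof. by rewrite /hausdorff_dist maxC. Qed.

Lemma hausdorff_distxx Y : Y !=set0 -> hausdorff_dist Y Y = 0.
Proof.
move=> [y Yy]; rewrite /hausdorff_dist maxxx.
suff -> : [set set_dist y Y | y in Y] = [set 0] by rewrite sup1.
apply/seteqP; split => [_ [x Yx <-]|_ ->] /=; first by rewrite set_dist0.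
by exists y => //; rewrite set_dist0.
Qed.

Lemma hausdorff_dist_eq0 Y Z : Y !=set0 -> compact Y ->
  Z !=set0 -> compact Z -> hausdorff_dist Y Z = 0 -> Y = Z.
Proof.
move=> Y0 cY Z0 cZ YZ.
have [] := (hausdorff_dist_le 0 Y0 cY Z0 cZ).1; first by rewrite YZ.
move=> sYZ sZY; apply/seteqP; split => x Xx; apply: set_dist_eq0 => //.
  by apply/eqP; rewrite eq_le sYZ// set_dist_ge0.
by apply/eqP; rewrite eq_le sZY// set_dist_ge0.
Qed.

Lemma hausdorff_dist_triangle W Y Z : W !=set0 -> compact W ->
    Y !=set0 -> compact Y -> Z !=set0 -> compact Z ->
  hausdorff_dist Y Z <= hausdorff_dist Y W + hausdorff_dist W Z.
Proof.
move=> W0 cW Y0 cY Z0 cZ.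
have key A B : A !=set0 -> compact A -> B !=set0 -> compact B ->
    forall a, A a -> set_dist a B <= hausdorff_dist A W + hausdorff_dist W B.
  move=> A0 cA B0 cB a Aa; apply/ler_addgt0Pl => e e0.
  have [w Ww we] := set_dist_lt a W0 e0.
  have [/(_ _ Aa) aW _] := (hausdorff_dist_le _ A0 cA W0 cW).1 (lexx _).
  have [/(_ _ Ww) wB _] := (hausdorff_dist_le _ W0 cW B0 cB).1 (lexx _).
  rewrite (le_trans (set_dist_triangle a w B0))// addrA lerD//.
  by rewrite (le_trans (ltW we))// [e + _]addrC lerD2r.
apply/hausdorff_dist_le => //; split; first exact: key.
move=> z Zz; rewrite addrC (hausdorff_dist_sym Y) (hausdorff_dist_sym W).
exact: key.
Qed.

End hausdorff_distance.

Definition full_shift (n : nat) : Type :=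
  {ptws int -> discrete_topology 'I_n}.

HB.instance Definition _ (n : nat) := Topological.on (full_shift n).

Definition shift_map (n : nat) (x : full_shift n) : full_shift n :=
  fun i => x (i + 1).

(* The parameter [d] does not occur in the fields: it selects the Hausdorff
   metric put on the type of subshifts below. *)
Record subshift (R : realType) (n : nat)
    (d : compatible_metric R (full_shift n)) := Subshift {
  subshift_set :> set (full_shift n);
  subshift_nonempty : subshift_set !=set0;
  subshift_compact : compact subshift_set;
  subshift_invariant : @shift_map n @` subshift_set = subshift_set
}.

Section subshift_space.
Context {R : realType} {n : nat} (d : compatible_metric R (full_shift n)).

Lemma subshift_inj (Y Z : subshift d) : Y = Z :> set (full_shift n) -> Y = Z.
Proof.
case: Y Z => [Y Y0 cY sY] [Z Z0 cZ sZ] /= YZ; case: _ / YZ in Z0 cZ sZ *.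
by congr Subshift; exact: Prop_irrelevance.
Qed.

HB.instance Definition _ := gen_eqMixin (subshift d).
HB.instance Definition _ := gen_choiceMixin (subshift d).

Let hdist (Y Z : subshift d) : R := hausdorff_dist d Y Z.

Let hdistxx Y : hdist Y Y = 0.
Proof. exact/hausdorff_distxx/subshift_nonempty. Qed.

Let hdist_positivity Y Z : hdist Y Z = 0 -> Y = Z.
Proof.
move=> YZ; apply/subshift_inj/(hausdorff_dist_eq0 _ _ _ _ YZ);
by [exact: subshift_nonempty | exact: subshift_compact].
Qed.

Let hdist_sym Y Z : hdist Y Z = hdist Z Y.
Proof. exact: hausdorff_dist_sym. Qed.

Let hdist_triangle W Y Z : hdist Y Z <= hdist Y W + hdist W Z.
Proof.
by apply: hausdorff_dist_triangle;
  by [exact: subshift_nonempty | exact: subshift_compact].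
Qed.

HB.instance Definition _ := isMetric.Build R (subshift d)
  hdistxx hdist_positivity hdist_sym hdist_triangle.

Lemma subshift_mdistE (Y Z : subshift d) : mdist Y Z = hausdorff_dist d Y Z.
Proof. by []. Qed.

Definition chain_recurrent (Y : subshift d) : Prop :=
  forall x, subshift_set Y x -> forall e : R, 0 < e ->
  exists (r : nat) (u : nat -> full_shift n),
    [/\ (1 <= r)%N, u 0%N = x, u r = x,
        forall i, (i <= r)%N -> subshift_set Y (u i) &
        forall i, (i < r)%N -> d (shift_map (u i)) (u i.+1) < e].

Definition chain_recurrent_subshifts : set (subshift d) :=
  [set Y | chain_recurrent Y].

Definition finite_subshifts : set (subshift d) :=
  [set Y | finite_set (Y : set (full_shift n))].

End subshift_space.

Arguments chain_recurrent_subshifts {R n} d.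
Arguments finite_subshifts {R n} d.

(* Main.v *)
Require Import Defs.
From mathcomp Require Import all_boot all_order all_algebra.
From mathcomp Require Import all_classical all_reals all_analysis.
From mathcomp Require Import zify lra.
Local Open Scope classical_set_scope.
Set Implicit Arguments.
Unset Strict Implicit.
Unset Printing Implicit Defensive.
Import Order.TTheory GRing.Theory Num.Theory.
Local Open Scope ring_scope.

(** By compactness, closeness for [d] and agreement of coordinates on a central
window [-m, m] control each other uniformly ([dist_lt_agree],
[agree_dist_lt]), so both inclusions can be argued on windows.

Let [Y] be chain recurrent. If the errors of a loop u 0, ..., u r = u 0 in [Y]
are so small that the shift of u i agrees with u (i+1) on [-m, m], then the
r-periodic sequence whose i-th symbol is the central symbol of u (i mod r)
follows the loop: moving along the loop and moving inside one of its points
read the same symbols as long as the window is not left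
([pseudo_orbit_tracing]). Its orbit is finite, looks like [Y] through the
window, and comes close to the base point u 0. Since only finitely many words
occur in the window, a union of finitely many such orbits comes close to every
point of [Y]; it is a finite subshift close to [Y].

Conversely, the shift is injective, so every point of a finite subshift [Z] is
periodic and its orbit is an exact loop. If [Z] is close to [Y], replacing each
point of this loop by a nearby point of [Y] gives a loop in [Y] with small
errors, by uniform continuity of the shift. *)

(** * Cylinders and the metric *)

Definition agree (n m : nat) (x y : full_shift n) : Prop :=
  forall i : int, (`|i| <= m)%N -> x i = y i.

Lemma agree_sym (n m : nat) (x y : full_shift n) : agree m x y -> agree m y x.
Proof. by move=> xy i im; rewrite xy. Qed.

Lemma agree_trans (n m : nat) (y x z : full_shift n) :
  agree m x y -> agree m y z -> agree m x z.
Proof. by move=> xy yz i im; rewrite xy// yz. Qed.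

Lemma agreeW (n m k : nat) (x y : full_shift n) :
  (k <= m)%N -> agree m x y -> agree k x y.
Proof. by move=> km xy i ik; apply: xy; exact: leq_trans km. Qed.

Lemma agree_shift_map (n m : nat) (x y : full_shift n) :
  agree m.+1 x y -> agree m (shift_map x) (shift_map y).
Proof. by move=> xy i im; apply: xy; lia. Qed.

Lemma nbhs_coord (n : nat) (x : full_shift n) (i : int) :
  nbhs x [set y : full_shift n | x i = y i].
Proof.
have := @proj_continuous int (fun=> discrete_topology 'I_n) i x.
move=> /(_ [set a | x i = a]); apply.
by apply: filterS (discrete_set1 _) => a ->.
Qed.

Lemma nbhs_agree (n m : nat) (x : full_shift n) :
  nbhs x [set y | agree m x y].
Proof.
have xk (k : nat) : nbhs x [set y : full_shift n |
    forall i : int, (`|i| < k)%N -> x i = y i].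
  elim: k => [|k IH]; first by apply: filterE => y i.
  apply: filterS (filterI IH (filterI (nbhs_coord x k%:Z)
    (nbhs_coord x (- k%:Z)))) => y [yk [ykp ykn]] i ik.
  have [/yk//|ki] := ltnP `|i| k.
  by have [->//|->//] : i = k%:Z \/ i = - k%:Z by lia.
by apply: filterS (xk m.+1) => y xy i im; exact: xy.
Qed.

(** Cylinders form a basis of the product topology: the filter that they
generate at [x] converges to [x], because each coordinate is eventually
constant along it. *)
Lemma agree_nbhs (n : nat) (x : full_shift n) (A : set (full_shift n)) :
  nbhs x A -> exists m, [set y | agree m x y] `<=` A.
Proof.
pose F := filter_from [set: nat] (fun m => [set y : full_shift n | agree m x y]).
have FF : Filter F.
  apply: filter_from_filter; first by exists 0%N.
  move=> i j _ _; exists (maxn i j) => // y xy.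
  by split; apply: agreeW xy; lia.
have Fx : F --> x.
  apply/cvg_sup => i; apply/cvg_image.
    by rewrite eqEsubset; split => v // _; exists (cst v).
  move=> /= B /nbhs_singleton Bx; exists [set y : full_shift n | B (y i)].
    by exists `|i|%N => // y xy; rewrite /= -(xy i).
  apply/seteqP; split => [_ [y By <-]//|b Bb].
  by exists (cst b).
by move=> /Fx [m _ mA]; exists m.
Qed.

Lemma compact_full_shift (n : nat) : compact [set: full_shift n].
Proof.
have fin : compact [set: discrete_topology 'I_n].
  by apply: finite_compact; exact: (@finite_finset 'I_n).
have := @tychonoff int (fun=> discrete_topology 'I_n) (fun=> setT) (fun=> fin).
by congr compact; apply/seteqP; split.
Qed.

Section metric_and_cylinders.
Context {R : realType} {n : nat} (d : compatible_metric R (full_shift n)).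

(** Around each point this holds because cylinders are a basis of
neighbourhoods; compactness of the full shift makes the window independent of
the point. *)
Lemma dist_lt_agree (e : R) : 0 < e ->
  exists m, forall x y : full_shift n, agree m x y -> d x y < e.
Proof.
move=> e0.
have /compact_near_coveringP/(_ nat (nbhs \oo)
  (fun m x => forall y, agree m x y -> d x y < e)) := @compact_full_shift n.
case.
- move=> x _; have e2 : 0 < e / 2 by rewrite divr_gt0.
  have [m0 m0e] : exists m, [set y | agree m x y] `<=` [set y | d x y < e / 2].
    by apply/agree_nbhs/(cdist_nbhs d); exists (e / 2).
  exists ([set y | agree m0 x y], [set m | (m0 <= m)%N]).
    by split; [exact: nbhs_agree|exists m0].
  move=> [x' m] [/= xx' m0m] y x'y.
  have /m0e/= := xx'.
  have /m0e/= : agree m0 x y by apply: agree_trans xx' _; exact: agreeW x'y.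
  have := cdist_triangle d x x' y; rewrite (cdist_sym d x' x); lra.
- move=> m _ mP; exists m => x y; apply: (mP m) => //=.
Qed.

(** The Lebesgue number of the clopen partition of the full shift into
cylinders over the window [-m, m]. *)
Lemma agree_dist_lt (m : nat) :
  exists2 e : R, 0 < e & forall x y : full_shift n, d x y < e -> agree m x y.
Proof.
have /compact_near_coveringP/(_ R (0^'+)
  (fun e x => forall y, d x y < e -> agree m x y)) := @compact_full_shift n.
case.
- move=> x _; have /(cdist_nbhs d)[e e0 em] := nbhs_agree m x.
  have e2 : 0 < e / 2 by rewrite divr_gt0.
  exists ([set y | d x y < e / 2], [set t | t < e / 2]).
    by split; [apply/(cdist_nbhs d); exists (e / 2)|exact: nbhs_right_lt].
  move=> [x' t] [/= xx' te] y x'y.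
  apply: (@agree_trans n m x).
    by apply/agree_sym/em => /=; lra.
  by apply: em => /=; have := cdist_triangle d x' x y; lra.
- move=> t /= t0 tP; exists (t / 2); first by rewrite divr_gt0.
  move=> x y; apply: (tP (t / 2)) => //=; last by rewrite divr_gt0.
  by rewrite sub0r normrN gtr0_norm; lra.
Qed.

Lemma shift_map_unif_continuous (e : R) : 0 < e ->
  exists2 t : R, 0 < t &
    forall x y, d x y < t -> d (shift_map x) (shift_map y) < e.
Proof.
move=> /dist_lt_agree[m me]; have [t t0 tm] := agree_dist_lt m.+1.
by exists t => // x y /tm /agree_shift_map /me.
Qed.

End metric_and_cylinders.

(** * Orbits under powers of the shift *)

Definition shift_by (n : nat) (k : int) (x : full_shift n) : full_shift n :=
  fun i => x (i + k).

(** The orbit is two-sided so that it is invariant with image exactly itself,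
whether or not [x] is periodic. *)
Definition orbit_set (n : nat) (x : full_shift n) : set (full_shift n) :=
  [set shift_by k x | k in [set: int]].

Lemma shift_by0 (n : nat) (x : full_shift n) : shift_by 0 x = x.
Proof. by apply/funext => i; rewrite /shift_by addr0. Qed.

Lemma shift_map_by (n : nat) (k : int) (x : full_shift n) :
  shift_map (shift_by k x) = shift_by (k + 1) x.
Proof. by apply/funext => i; rewrite /shift_map /shift_by -addrA (addrC 1). Qed.

Lemma shift_map_inj (n : nat) : injective (@shift_map n).
Proof.
move=> x y xy; apply/funext => i.
have := congr1 (fun z : full_shift n => z (i - 1)) xy.
by rewrite /shift_map subrK.
Qed.

Lemma orbit_set_invariant (n : nat) (x : full_shift n) :
  @shift_map n @` orbit_set x = orbit_set x.
Proof.
apply/seteqP; split => [_ [_ [k _ <-] <-]|_ [k _ <-]].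
  by exists (k + 1) => //; rewrite shift_map_by.
by exists (shift_by (k - 1) x); [exists (k - 1)|rewrite shift_map_by subrK].
Qed.

Lemma finite_orbit_set (n r : nat) (x : full_shift n) : (0 < r)%N ->
  (forall i : int, x i = x (i %% r)%Z) -> finite_set (orbit_set x).
Proof.
move=> r0 xr.
apply: (@sub_finite_set _ _ ((fun k : 'I_r => shift_by k%:Z x) @` setT)).
  move=> _ [k _ <-].
  have kr : (`|(k %% r)%Z|%N < r)%N by lia.
  exists (Ordinal kr) => //; apply/funext => i; rewrite /shift_by /=.
  rewrite xr [RHS]xr gez0_abs ?modz_ge0 ?modzDmr//; lia.
by apply: finite_image; exact: finite_finset.
Qed.

(** Pigeonhole gives two equal iterates; injectivity of the shift cancels the
smaller exponent, so that [z] itself returns. *)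
Lemma finite_invariant_periodic (n : nat) (Z : set (full_shift n)) z :
  finite_set Z -> (forall y, Z y -> Z (shift_map y)) -> Z z ->
  exists2 r, (0 < r)%N & iter r (@shift_map n) z = z.
Proof.
move=> Zfin ZS Zz; pose f k := iter k (@shift_map n) z.
have Zf k : Z (f k) by elim: k => [//|k IH]; exact: ZS.
have [i [j [ij fij]]] : exists i j, (i < j)%N /\ f i = f j.
  apply: contrapT => H; apply: infinite_nat.
  have -> : [set: nat] = f @^-1` Z by apply/seteqP; split => // k _; exact: Zf.
  apply: finite_preimage Zfin => i j _ _ fij; apply: contrapT => ij.
  have [lt_ij|lt_ji|//] := ltngtP i j; apply: H; [exists i, j|exists j, i] => //.
exists (j - i)%N; first by rewrite subn_gt0.
have injf k : injective (iter k (@shift_map n)).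
  by elim: k => [//|k IH] a b /shift_map_inj; exact: IH.
apply: (injf i); rewrite -iterD subnKC; last exact: ltnW.
by rewrite -/(f j) -fij.
Qed.

(** * Limits of finite subshifts are chain recurrent *)

(** A closed orbit of a nearby finite subshift is moved point by point into
[Y], with both of its ends sent to the prescribed base point. *)
Lemma closure_finite_chain_recurrent (R : realType) (n : nat)
    (d : compatible_metric R (full_shift n)) :
  closure (finite_subshifts d) `<=` chain_recurrent_subshifts d.
Proof.
move=> Y clY x Yx e e0.
have e2 : 0 < e / 2 by rewrite divr_gt0.
(* An error of the new loop is at most the sum of d (shift (u i)) (shift (f i))
   and d (f (i+1)) (u (i+1)), each below e / 2. Passing from [hausdorff_dist]
   at most [s] to actual points costs another [s], hence the bounds on 2 s. *)
have [t t0 tS] := shift_map_unif_continuous d e2.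
pose s := Num.min t (e / 2) / 2.
have s0 : 0 < s by rewrite divr_gt0// lt_min t0 e2.
have [st se] : 2 * s <= t /\ 2 * s <= e / 2.
  have -> : 2 * s = Num.min t (e / 2) by rewrite /s; lra.
  by rewrite !ge_min !lexx orbT.
have [Z [/= Zfin YZ]] := clY _ (nbhsx_ballx Y s s0).
have {YZ} : hausdorff_dist d Y Z <= s.
  by move: YZ; rewrite ballEmdist/= subshift_mdistE => /ltW.
move=> /hausdorff_dist_le[]; try by [exact: subshift_nonempty|exact: subshift_compact].
move=> YZ ZY.
have [z Zz xz] := set_dist_lt d x (subshift_nonempty Z) s0.
have ZS y : subshift_set Z y -> subshift_set Z (shift_map y).
  by move=> Zy; rewrite -[X in X _](subshift_invariant Z); exists y.
have [r r0 rz] := finite_invariant_periodic Zfin ZS Zz.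
have near_Y w : subshift_set Z w -> exists y, subshift_set Y y /\ d w y < 2 * s.
  move=> Zw; have [y Yy wy] := set_dist_lt d w (subshift_nonempty Y) s0.
  by exists y; split => //; have := ZY _ Zw; lra.
pose f k := iter k (@shift_map n) z.
have Zf k : subshift_set Z (f k) by elim: k => [//|k IH]; exact: ZS.
have [g gP] := choice (fun k => near_Y (f k) (Zf k)).
pose u k := if (k == 0%N) || (k == r) then x else g k.
have uP k : (k <= r)%N -> subshift_set Y (u k) /\ d (f k) (u k) < 2 * s.
  move=> _; rewrite /u; case: ifPn => [k0r|_]; last exact: gP.
  split=> //; have -> : f k = z by case/orP: k0r => /eqP ->.
  by rewrite cdist_sym; have := YZ _ Yx; lra.
exists r, u; split => //.
- by rewrite /u eqxx orbT.
- by move=> i /uP[].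
- move=> i ir; have [_ fu] := uP i (ltnW ir); have [_ fu1] := uP i.+1 ir.
  have : d (shift_map (u i)) (shift_map (f i)) < e / 2.
    by apply: tS; rewrite cdist_sym; lra.
  by have := cdist_triangle d (f i.+1) (shift_map (u i)) (u i.+1); rewrite /=; lra.
Qed.

(** * Chain recurrent subshifts are limits of finite ones *)

(** The j-th symbol of [v k] is the symbol j-1 of [v (k + 1)], as long as j-1
stays in the window; after j such steps it has become the central symbol of
[v (k + j)]. Negative j are reached by stepping back. Thus a pseudo-orbit whose
errors are invisible in the window is traced, in the same window, by a
genuine orbit. *)
Lemma pseudo_orbit_tracing (n m : nat) (v : int -> full_shift n) :
  (forall k, agree m (shift_map (v k)) (v (k + 1))) ->
  forall k, agree m (v k) (shift_by k (fun i => v i 0)).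
Proof.
move=> vS.
have fwd (a : nat) k : (a <= m)%N -> v k a%:Z = v (k + a%:Z) 0.
  elim: a k => [|a IH] k am; first by rewrite addr0.
  have -> : k + a.+1%:Z = k + 1 + a%:Z by lia.
  rewrite -IH; last by lia.
  by rewrite -(vS k); [rewrite /shift_map -PoszD addn1|lia].
have bwd (a : nat) k : (a <= m)%N -> v k (- a%:Z) = v (k - a%:Z) 0.
  elim: a k => [|a IH] k am; first by rewrite oppr0 addr0.
  have -> : k - a.+1%:Z = k - 1 - a%:Z by lia.
  rewrite -IH; last by lia.
  rewrite -{1}(subrK 1 k) -(vS (k - 1)); last by lia.
  by rewrite /shift_map; congr (v _ _); lia.
move=> k i im; rewrite /shift_by addrC.
have [i0|i0] := leP 0 i.
  by have := fwd `|i|%N k im; rewrite gez0_abs.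
have := bwd `|i|%N k im; rewrite lez0_abs ?opprK//; lia.
Qed.

(** A closed chain is repeated periodically to get a bi-infinite pseudo-orbit,
so that the point tracing it is periodic and has a finite orbit. *)
Lemma chain_traced (n m r : nat) (Y : set (full_shift n)) (u : nat -> full_shift n) :
  (0 < r)%N -> u r = u 0%N -> (forall i, (i <= r)%N -> Y (u i)) ->
  (forall i, (i < r)%N -> agree m (shift_map (u i)) (u i.+1)) ->
  exists z : full_shift n, [/\ finite_set (orbit_set z), agree m (u 0%N) z &
    forall w, orbit_set z w -> exists2 y, Y y & agree m y w].
Proof.
move=> r0 ur uY uS; pose v (k : int) := u `|(k %% r)%Z|%N.
(* The index r is allowed although residues stay below r: closing the chain,
   u r = u 0, is what makes the step from residue r-1 to residue 0 legitimate. *)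
have vE k (i : nat) : (i <= r)%N -> (k %% r)%Z = (i%:Z %% r)%Z -> v k = u i.
  rewrite /v leq_eqVlt => /orP[/eqP -> ->|ir ->]; first by rewrite modzz.
  by rewrite modz_small//; lia.
have vS k : agree m (shift_map (v k)) (v (k + 1)).
  have kr : (`|(k %% r)%Z| < r)%N by lia.
  rewrite (vE (k + 1) `|(k %% r)%Z|.+1 kr); first exact: uS.
  by rewrite -addn1 PoszD gez0_abs ?modzDml// modz_ge0//; lia.
have tr := pseudo_orbit_tracing vS.
exists (fun i => v i 0); split.
- by apply: (finite_orbit_set r0) => i; rewrite /v modz_mod.
- by have := tr 0; rewrite shift_by0 (vE 0 0%N).
- by move=> _ [k _ <-]; exists (v k) => //; apply: uY; lia.
Qed.

Definition window (n m : nat) (x : full_shift n) : {ffun 'I_m.*2.+1 -> 'I_n} :=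
  [ffun i : 'I_m.*2.+1 => (x (i%:Z - m%:Z) : 'I_n)].

Lemma agree_window (n m : nat) (x y : full_shift n) :
  window m x = window m y -> agree m x y.
Proof.
move=> xy i im; have im2 : (absz (i + m%:Z)%R < m.*2.+1)%N by lia.
have /= := congr1 (fun f : {ffun _ -> _} => f (Ordinal im2)) xy.
rewrite !ffunE /= gez0_abs ?addrK//; lia.
Qed.

(** Points with the same word in the window can share one finite orbit, and
there are finitely many words. Words that do not occur in [Y] contribute the
empty set. *)
Lemma finite_invariant_approx (n m : nat) (Y : set (full_shift n)) :
  (forall x, Y x -> exists z : full_shift n,
    [/\ finite_set (orbit_set z), agree m x z &
        forall w, orbit_set z w -> exists2 y, Y y & agree m y w]) ->
  exists Z : set (full_shift n), [/\ finite_set Z, @shift_map n @` Z = Z,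
    forall x, Y x -> exists2 z, Z z & agree m x z &
    forall z, Z z -> exists2 y, Y y & agree m z y].
Proof.
move=> YP.
have Ap (p : {ffun 'I_m.*2.+1 -> 'I_n}) : exists A : set (full_shift n),
  [/\ finite_set A, @shift_map n @` A = A,
    forall x, Y x -> window m x = p -> exists2 z, A z & agree m x z &
    forall z, A z -> exists2 y, Y y & agree m z y].
  have [[x [Yx <-]]|noY] := pselect (exists x, Y x /\ window m x = p).
    have [z [zfin xz zY]] := YP _ Yx.
    exists (orbit_set z); split => //; first exact: orbit_set_invariant.
    - move=> x' _ /agree_window x'x; exists z; last exact: agree_trans x'x xz.
      by exists 0 => //; exact: shift_by0.
    - by move=> w /zY[y Yy yw]; exists y => //; exact: agree_sym.
  exists set0; split => //; first by rewrite image_set0.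
  by move=> x Yx xp; case: noY; exists x.
have [A AP] := choice Ap.
exists (\bigcup_p A p); split.
- by apply: bigcup_finite => [|p _]; [exact: finite_finset|case: (AP p)].
- by rewrite image_bigcup; apply: eq_bigcupr => p _; case: (AP p).
- move=> x Yx; have [_ _ /(_ x Yx erefl)[z Az xz] _] := AP (window m x).
  by exists z => //; exists (window m x).
- by move=> z [p _ Az]; have [_ _ _] := AP p; apply.
Qed.

Lemma chain_recurrent_closure_finite (R : realType) (n : nat)
    (d : compatible_metric R (full_shift n)) :
  chain_recurrent_subshifts d `<=` closure (finite_subshifts d).
Proof.
move=> Y crY B /nbhs_ballP[e /= e0 eB].
have e2 : 0 < e / 2 by rewrite divr_gt0.
have [m me] := dist_lt_agree d e2.
have [t t0 tm] := agree_dist_lt d m.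
have [|Z [Zfin ZS YZ ZY]] := @finite_invariant_approx n m (subshift_set Y).
  move=> x Yx; have [r [u [r0 u0 ur uY uS]]] := crY x Yx t t0.
  rewrite -u0; apply: (chain_traced r0 _ uY); first by rewrite u0.
  by move=> i /uS /tm.
have Z0 : Z !=set0.
  by have [x /YZ[z Zz _]] := subshift_nonempty Y; exists z.
exists (Subshift d Z0 (finite_compact Zfin) ZS); split; first exact: Zfin.
apply: eB; rewrite ballEmdist/= subshift_mdistE/=.
apply: (@le_lt_trans _ _ (e / 2)); last by lra.
apply/hausdorff_dist_le; [exact: subshift_nonempty|exact: subshift_compact|
  exact: Z0|exact: finite_compact|].
split => [y /YZ[z Zz yz]|z /ZY[y Yy zy]].
  by rewrite (le_trans (set_dist_le d y Zz))// ltW// me.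
by rewrite (le_trans (set_dist_le d z Yy))// ltW// me.
Qed.

Theorem proposition5p4 (R : realType) (n : nat) (hn : (2 <= n)%N)
    (d : compatible_metric R (full_shift n)) :
  chain_recurrent_subshifts d = closure (finite_subshifts d).
Proof.
apply/seteqP; split.
  exact: chain_recurrent_closure_finite.
exact: closure_finite_chain_recurrent.
Qed.
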